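(* Let $\mathcal{V}$ be a vector space over a field $\mathbb{F}$ and let $P:\mathcal{V}\to\mathcal{V}$ be a linear operator with a factorisation $P=P_0P_1\cdots P_\ell$ that is a decomposition of $P$. Then the space $\mathcal{W}_P$ of weak symmetries of $P$ has a canonical vector space decomposition $$\mathcal{W}_P\cong\bigoplus_{i,j=0}^{\ell}\mathcal{W}_{ij}.$$
   Context: Write $\mathcal{V}_P$ for the kernel of $P$ and $\mathcal{V}_i$ for the kernel of $P_i$. A weak symmetry of $P$ is a linear operator $S:\mathcal{V}_P\to\mathcal{V}$ whose image lies in $\mathcal{V}_P$; $\mathcal{W}_P$ is the vector space of weak symmetries of $P$. $\mathcal{W}_{ij}$ is the vector space of linear homomorphisms $H:\mathcal{V}_j\to\mathcal{V}_i$. Definition (decomposition): for a linear operator $P:\mathcal{V}\to\mathcal{V}$, an expression $P=P_0P_1\cdots P_\ell$ as a composition of linear operators $P_i:\mathcal{V}\to\mathcal{V}$ is a decomposition of $P$ if $\ell\ge1$ and there exist linear operators $Q_i:\mathcal{V}\to\mathcal{V}$, $i=0,\ldots,\ell$, with $$\mathrm{id}_{\mathcal{V}}=Q_0P^0+\cdots+Q_\ell P^\ell,\qquad P^i:=\prod_{j\ne i,\,0\le j\le\ell}P_j,$$ and $P_iP_j=P_jP_i$, $P_iQ_j=Q_jP_i$ for all $i,j\in\{0,\ldots,\ell\}$. *)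

(* Defs.v *)
From HB Require Import structures.
From mathcomp Require Import all_boot all_order all_algebra.
From mathcomp Require Import boolp classical_sets functions.

Set Implicit Arguments.
Unset Strict Implicit.
Unset Printing Implicit Defensive.

Import GRing.Theory.
Local Open Scope ring_scope.

(* [{linear U -> V}] as a subspace of the space [U -> V] of all functions
   (with pointwise operations). *)
Section LinearSpace.
Variables (F : fieldType) (U V : lmodType F).

Definition linear_pred : {pred U -> V} := fun f => `[< linear f >].

Lemma linear_pred_submod : submod_closed linear_pred.
Proof.
split=> [|a f g /asboolP lf /asboolP lg].
  by apply/asboolP => a x y; rewrite /= scaler0 addr0.
apply/asboolP => b x y.
rewrite -[LHS]/(a *: f (b *: x + y) + g (b *: x + y)).
rewrite -[RHS]/(b *: (a *: f x + g x) + (a *: f y + g y)).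
rewrite lf lg !scalerDr !scalerA [b * a]mulrC -!addrA; congr (_ + _).
by rewrite addrCA.
Qed.

HB.instance Definition _ :=
  GRing.isSubmodClosed.Build F (U -> V) linear_pred linear_pred_submod.

Lemma linear_eq (f g : {linear U -> V}) : (f : U -> V) = g -> f = g.
Proof.
case: f g => f [[f1] [f2]] [g [[g1] [g2]]] /= fg; subst g.
by congr (GRing.Linear.Pack (GRing.Linear.Class _ _));
  congr (_ _); exact: Prop_irrelevance.
Qed.

Definition linear_sub (f : U -> V) (fP : f \in linear_pred) : {linear U -> V} :=
  HB.pack f (GRing.isLinear.Build F U V *:%R f (asboolW fP)).

Lemma linear_rect (K : {linear U -> V} -> Type) :
  (forall f (fP : f \in linear_pred), K (linear_sub fP)) -> forall u, K u.
Proof.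
move=> Ksub u; have uP : (u : U -> V) \in linear_pred.
  by apply/asboolP; exact: linearP.
suff -> : u = linear_sub uP by [].
exact: linear_eq.
Qed.

Lemma linear_subK f (fP : f \in linear_pred) : linear_sub fP = f :> (U -> V).
Proof. by []. Qed.

HB.instance Definition _ :=
  @isSub.Build (U -> V) linear_pred {linear U -> V} _ linear_sub
    linear_rect linear_subK.
HB.instance Definition _ := [Choice of {linear U -> V} by <:].
HB.instance Definition _ := [SubChoice_isSubLmodule of {linear U -> V} by <:].

End LinearSpace.

(* The ring of linear operators on a space, with composition as product. *)
Section LinearRing.
Variables (F : fieldType) (V : lmodType F).
Implicit Types f g h : {linear V -> V}.

Definition linear_comp f g : {linear V -> V} := f \o g.
Definition linear_id : {linear V -> V} := idfun.

Lemma linear_compA : associative linear_comp.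
Proof. by move=> f g h; apply: linear_eq. Qed.
Lemma linear_comp1l : left_id linear_id linear_comp.
Proof. by move=> f; apply: linear_eq. Qed.
Lemma linear_comp1r : right_id linear_id linear_comp.
Proof. by move=> f; apply: linear_eq. Qed.
Lemma linear_compDl : left_distributive linear_comp +%R.
Proof. by move=> f g h; apply: linear_eq. Qed.
Lemma linear_compDr : right_distributive linear_comp +%R.
Proof.
move=> f g h; apply: linear_eq; apply: funext => x.
by rewrite -[LHS]/(f (g x + h x)) linearD.
Qed.

HB.instance Definition _ := GRing.Zmodule_isPzRing.Build {linear V -> V}
  linear_compA linear_comp1l linear_comp1r linear_compDl linear_compDr.

End LinearRing.

Section Kernel.
Variables (F : fieldType) (U V : lmodType F) (P : {linear U -> V}).

Definition ker_pred : {pred U} := [pred x | P x == 0].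

Lemma ker_pred_submod : submod_closed ker_pred.
Proof.
split=> [|a x y]; rewrite !inE ?linear0 // => /eqP Px /eqP Py.
by rewrite linearP Px Py scaler0 addr0.
Qed.

HB.instance Definition _ :=
  GRing.isSubmodClosed.Build F U ker_pred ker_pred_submod.

Record kernel := Kernel { kerval :> U; _ : kerval \in ker_pred }.

HB.instance Definition _ := [isSub for kerval].
HB.instance Definition _ := [Choice of kernel by <:].
HB.instance Definition _ := [SubChoice_isSubLmodule of kernel by <:].

End Kernel.

Section WeakSymmetry.
Variables (F : fieldType) (V : lmodType F) (P : {linear V -> V}).

Definition weak_sym_pred : {pred {linear kernel P -> V}} :=
  fun S => `[< forall x : kernel P, S x \in ker_pred P >].

Lemma weak_sym_pred_submod : submod_closed weak_sym_pred.
Proof.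
split=> [|a S T /asboolP SP /asboolP TP]; apply/asboolP => x.
  exact: rpred0.
rewrite -[_ x]/(a *: S x + T x).
by apply: rpredD => //; apply: rpredZ.
Qed.

HB.instance Definition _ := GRing.isSubmodClosed.Build F
  {linear kernel P -> V} weak_sym_pred weak_sym_pred_submod.

Record weak_sym :=
  WeakSym { weak_symval :> {linear kernel P -> V};
            _ : weak_symval \in weak_sym_pred }.

HB.instance Definition _ := [isSub for weak_symval].
HB.instance Definition _ := [Choice of weak_sym by <:].
HB.instance Definition _ := [SubChoice_isSubLmodule of weak_sym by <:].

End WeakSymmetry.

(* The index set is finite, so the direct sum consists of all families. *)
Section DirectSum.
Variables (F : fieldType) (I : finType) (W : I -> lmodType F).

Definition dirsum : Type := forall i, W i.
Implicit Types u v w : dirsum.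

HB.instance Definition _ := gen_eqMixin dirsum.
HB.instance Definition _ := gen_choiceMixin dirsum.

Definition dirsum_zero : dirsum := fun=> 0.
Definition dirsum_opp u : dirsum := fun i => - u i.
Definition dirsum_add u v : dirsum := fun i => u i + v i.
Definition dirsum_scale (a : F) u : dirsum := fun i => a *: u i.

Lemma dirsum_addA : associative dirsum_add.
Proof. by move=> u v w; apply: functional_extensionality_dep => i; apply: addrA. Qed.
Lemma dirsum_addC : commutative dirsum_add.
Proof. by move=> u v; apply: functional_extensionality_dep => i; apply: addrC. Qed.
Lemma dirsum_add0 : left_id dirsum_zero dirsum_add.
Proof. by move=> u; apply: functional_extensionality_dep => i; apply: add0r. Qed.
Lemma dirsum_addN : left_inverse dirsum_zero dirsum_opp dirsum_add.
Proof. by move=> u; apply: functional_extensionality_dep => i; apply: addNr. Qed.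

HB.instance Definition _ := GRing.isZmodule.Build dirsum
  dirsum_addA dirsum_addC dirsum_add0 dirsum_addN.

Lemma dirsum_scaleA a b u :
  dirsum_scale a (dirsum_scale b u) = dirsum_scale (a * b) u.
Proof. by apply: functional_extensionality_dep => i; apply: scalerA. Qed.
Lemma dirsum_scale1 : left_id 1 dirsum_scale.
Proof. by move=> u; apply: functional_extensionality_dep => i; apply: scale1r. Qed.
Lemma dirsum_scaleDr : right_distributive dirsum_scale +%R.
Proof. by move=> a u v; apply: functional_extensionality_dep => i; apply: scalerDr. Qed.
Lemma dirsum_scaleDl u : {morph dirsum_scale^~ u : a b / a + b}.
Proof. by move=> a b; apply: functional_extensionality_dep => i; apply: scalerDl. Qed.

HB.instance Definition _ := GRing.Zmodule_isLmodule.Build F dirsum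
  dirsum_scaleA dirsum_scale1 dirsum_scaleDr dirsum_scaleDl.

End DirectSum.

Section Decomposition.
Variables (F : fieldType) (V : lmodType F) (l : nat).
Variables (P : {linear V -> V}) (Ps : 'I_l.+1 -> {linear V -> V}).

Definition prod_except (i : 'I_l.+1) : {linear V -> V} := \prod_(j | j != i) Ps j.

Definition is_decomposition : Prop :=
  [/\ (1 <= l)%N, P = \prod_i Ps i &
      exists Q : 'I_l.+1 -> {linear V -> V},
        [/\ 1 = \sum_i Q i * prod_except i,
            forall i j, Ps i * Ps j = Ps j * Ps i &
            forall i j, Ps i * Q j = Q j * Ps i]].

(* The index (i, j) carries the space of linear maps from ker P_j to ker P_i. *)
Definition hom_blocks : lmodType F :=
  dirsum (fun ij : 'I_l.+1 * 'I_l.+1 =>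
            {linear kernel (Ps ij.2) -> kernel (Ps ij.1)} : lmodType F).

(* H is the block matrix of S with respect to ker P = (+)_i ker P_i: on an
   element of ker P_j (written x in ker P, xj in ker P_j), S is the sum over i
   of the entries H_ij. *)
Definition block_matrix (S : weak_sym P) (H : hom_blocks) : Prop :=
  forall (j : 'I_l.+1) (x : kernel P) (xj : kernel (Ps j)),
    x = xj :> V -> S x = \sum_i (H (i, j) xj : V).

End Decomposition.

(* Main.v *)
Require Import Defs.
From HB Require Import structures.
From mathcomp Require Import all_boot all_order all_algebra.
From mathcomp Require Import boolp classical_sets functions.
Import GRing.Theory.
Local Open Scope ring_scope.

(** Put pi_i := Q_i P^i.  The identity 1 = sum_i Q_i P^i says that the pi_i add
up to the identity of V.  Three consequences of commutativity show that on
ker P they are the projections of a direct sum decomposition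
ker P = (+)_i ker P_i:
- P_i pi_i = Q_i P, hence pi_i maps ker P into ker P_i ([factor_component]);
- for j <> i, P_j can be moved to the right end of the product P^i, hence
  pi_i vanishes on ker P_j ([component_other]);
- so pi_i is the identity on ker P_i, as the other terms of the sum vanish
  there ([component_self]), and ker P_i lies in ker P ([factor_kerS]).

A weak symmetry is an endomorphism of ker P, and such an endomorphism is the
same thing as its matrix of blocks ker P_j -> ker P_i.  The defining equation
of this matrix, [block_matrix S H], is a relation between S and H in which the
Q_i do not occur.  It determines H from S, because pi_i applied to it extracts
the entry H_ij, and such an H always exists, namely H_ij = pi_i S restricted to
ker P_j ([block_matrixE]).  Conversely it determines S from H, because the
ker P_j span ker P ([block_matrix_inj]), and every H occurs: take
S = sum_ij H_ij pi_j ([assemble_block_matrix]).  These facts make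
S |-> (pi_i S restricted to ker P_j)_ij a bijection, and it is linear. *)

Set Implicit Arguments.
Unset Strict Implicit.
Unset Printing Implicit Defensive.

(** * Linear maps into a kernel *)

Section Corestriction.
Variables (F : fieldType) (U V W : lmodType F) (P : {linear V -> W}).

Lemma kerval_is_linear : linear (kerval (P := P)).
Proof. by move=> a x y. Qed.

HB.instance Definition _ :=
  GRing.isLinear.Build F (kernel P) V *:%R (kerval (P := P)) kerval_is_linear.

Lemma kernel_eq0 (x : kernel P) : P (kerval x) = 0.
Proof. by case: x => x /= /eqP. Qed.

Lemma kerval_inj : injective (kerval (P := P)).
Proof. exact: val_inj. Qed.

Variables (f : {linear U -> V}) (fP : forall u, P (f u) = 0).

Definition ker_lift_fun (u : U) : kernel P := Kernel (introT eqP (fP u)).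

Lemma ker_lift_is_linear : linear ker_lift_fun.
Proof. by move=> a u v; apply: kerval_inj; rewrite linearP /= linearP. Qed.

Definition ker_lift : {linear U -> kernel P} :=
  HB.pack ker_lift_fun
    (GRing.isLinear.Build F U (kernel P) *:%R ker_lift_fun ker_lift_is_linear).

End Corestriction.

Lemma linear_sumE (F : fieldType) (U V : lmodType F) (I : finType)
    (f : I -> {linear U -> V}) x : (\sum_i f i) x = \sum_i f i x.
Proof. exact: (big_morph (fun g : {linear U -> V} => g x)). Qed.

(** * Pulling a factor out of a product of commuting operators *)

(** The factors commute pairwise in a ring that need not be commutative, so the
chosen factor can be moved to the left past all those that precede it. *)
Lemma prod_commD1 (R : pzRingType) (I : eqType) (r : seq I) (p : pred I)
    (f : I -> R) i :
  (forall j k, f j * f k = f k * f j) -> uniq r -> i \in r -> p i ->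
  \prod_(j <- r | p j) f j = f i * \prod_(j <- r | p j && (j != i)) f j.
Proof.
move=> fC; elim: r => //= k r IHr /andP[kr Ur].
rewrite inE !big_cons; have [-> _ pi | neq_ik /= ir pi] := eqVneq i k.
  rewrite pi andbF /=; congr (_ * _).
  rewrite [LHS]big_seq_cond [RHS]big_seq_cond; apply: eq_bigl => j.
  by case: eqVneq kr => [-> /negPf -> | _ _]; rewrite ?andbT.
rewrite andbT IHr //; case: (p k) => //.
by rewrite !mulrA fC.
Qed.

(** * The decomposition of the kernel *)

Section Components.
Variables (F : fieldType) (V : lmodType F) (l : nat).
Variables (P : {linear V -> V}) (Ps Q : 'I_l.+1 -> {linear V -> V}).
Hypothesis defP : P = \prod_i Ps i.
Hypothesis PsC : forall i j, Ps i * Ps j = Ps j * Ps i.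
Hypothesis PsQC : forall i j, Ps i * Q j = Q j * Ps i.
Hypothesis partition1 : 1 = \sum_i Q i * prod_except Ps i.

Lemma factorD1 i : P = Ps i * prod_except Ps i.
Proof. by rewrite defP (prod_commD1 (i := i)) ?index_enum_uniq ?mem_index_enum. Qed.

Lemma factor_exceptC i j : Ps i * prod_except Ps j = prod_except Ps j * Ps i.
Proof. by apply: commr_prod => k _; apply: PsC. Qed.

Lemma prod_exceptD1 i j : j != i ->
  prod_except Ps i = (\prod_(k | (k != i) && (k != j)) Ps k) * Ps j.
Proof.
move=> neq_ji.
rewrite /prod_except (prod_commD1 (i := j)) ?index_enum_uniq ?mem_index_enum //.
by apply: commr_prod => k _; apply: PsC.
Qed.

(** The operator pi_i; its restriction to ker P is the projection onto
ker P_i. *)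
Definition component i : {linear V -> V} := Q i * prod_except Ps i.

Lemma sum_component x : \sum_i component i x = x.
Proof. by rewrite -linear_sumE -partition1. Qed.

(** P_i moves past Q_i and completes P^i to P. *)
Lemma factor_component i x : Ps i (component i x) = Q i (P x).
Proof.
rewrite -[LHS]/((Ps i * (Q i * prod_except Ps i)) x).
by rewrite mulrA PsQC -mulrA -factorD1.
Qed.

(** For j <> i the product P^i contains the factor P_j, which can be applied
first. *)
Lemma component_other i j x : j != i -> Ps j x = 0 -> component i x = 0.
Proof.
by move=> neq_ji Px; rewrite /component (prod_exceptD1 neq_ji) /= Px !linear0.
Qed.

(** In the resolution x = sum_k pi_k x only the i-th term survives. *)
Lemma component_self i x : Ps i x = 0 -> component i x = x.
Proof.
move=> Px; rewrite -[RHS]sum_component (bigD1 i) //= big1 ?addr0 // => j neq_ji.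
by apply: component_other Px; rewrite eq_sym.
Qed.

Lemma factor_kerS i x : Ps i x = 0 -> P x = 0.
Proof. by move=> Px; rewrite (factorD1 i) factor_exceptC /= Px linear0. Qed.

Lemma factor_component_kernel i (x : V) : P x = 0 -> Ps i (component i x) = 0.
Proof. by move=> Px; rewrite factor_component Px linear0. Qed.

Definition kernel_inclusion j : {linear kernel (Ps j) -> kernel P} :=
  ker_lift (f := kerval (P := Ps j)) (fun x => factor_kerS (kernel_eq0 x)).

Definition kernel_projection i : {linear kernel P -> kernel (Ps i)} :=
  ker_lift (f := component i \o kerval (P := P))
    (fun x => factor_component_kernel i (kernel_eq0 x)).

(** * The block matrix of a weak symmetry *)

Lemma weak_sym_ker (S : weak_sym P) x : P (S x) = 0.
Proof. by case: S => S /= /asboolP/(_ x)/eqP. Qed.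

Definition weak_sym_end (S : weak_sym P) : {linear kernel P -> kernel P} :=
  ker_lift (weak_sym_ker S).

Definition block (S : weak_sym P) i j : {linear kernel (Ps j) -> kernel (Ps i)} :=
  kernel_projection i \o (weak_sym_end S \o kernel_inclusion j).

Definition blocks (S : weak_sym P) : hom_blocks Ps := fun ij => block S ij.1 ij.2.

Lemma blocks_is_linear : linear blocks.
Proof.
move=> a S T; apply: functional_extensionality_dep => -[i j].
apply: linear_eq; apply: funext => y; apply: kerval_inj.
exact: (linearP (component i)).
Qed.

Definition blocks_linear : {linear weak_sym P -> hom_blocks Ps} :=
  HB.pack blocks (GRing.isLinear.Build F (weak_sym P) (hom_blocks Ps) *:%R
    blocks blocks_is_linear).

(** Applying pi_i to S y = sum_k H_kj y, with y in ker P_j, leaves H_ij y, as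
H_kj y lies in ker P_k.  Conversely, the entries pi_i S satisfy the equation
because the pi_i add up to the identity. *)
Lemma block_matrixE (S : weak_sym P) (H : hom_blocks Ps) :
  block_matrix S H <-> H = blocks S.
Proof.
split=> [SH | -> j x xj def_x].
  apply: functional_extensionality_dep => -[i j].
  apply: linear_eq; apply: funext => y; apply: kerval_inj.
  rewrite -[RHS]/(component i (S (kernel_inclusion j y))) (SH j _ y) //.
  rewrite (linear_sum (component i)) (bigD1 i) // component_self ?kernel_eq0 //.
  rewrite big1 => [|k neq_ki]; first by rewrite /= addr0.
  by apply: (component_other neq_ki); apply: kernel_eq0.
have -> : x = kernel_inclusion j xj by apply: kerval_inj.
by rewrite -[LHS]sum_component.
Qed.

(** A block matrix prescribes S on each ker P_j, and x = sum_j pi_j x writes every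
element of ker P as a sum of such vectors. *)
Lemma block_matrix_inj (S T : weak_sym P) (H : hom_blocks Ps) :
  block_matrix S H -> block_matrix T H -> S = T.
Proof.
move=> SH TH; apply: val_inj; apply: linear_eq; apply: funext => x /=.
have -> : x = \sum_j kernel_inclusion j (kernel_projection j x).
  by apply: kerval_inj; rewrite linear_sum /= sum_component.
rewrite !linear_sum; apply: eq_bigr => j _.
by rewrite (SH j _ (kernel_projection j x)) // (TH j _ (kernel_projection j x)).
Qed.

Definition extended_entry (H : hom_blocks Ps) i j : {linear kernel P -> V} :=
  kerval (P := Ps i) \o
  ((H (i, j) : {linear kernel (Ps j) -> kernel (Ps i)}) \o kernel_projection j).

Definition assemble_op (H : hom_blocks Ps) : {linear kernel P -> V} :=
  \sum_j \sum_i extended_entry H i j.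

Lemma assemble_opE H x :
  assemble_op H x = \sum_j \sum_i kerval (H (i, j) (kernel_projection j x)).
Proof. by rewrite linear_sumE; apply: eq_bigr => j _; rewrite linear_sumE. Qed.

Lemma assemble_weak_sym H : assemble_op H \in weak_sym_pred (P := P).
Proof.
apply/asboolP => x; rewrite assemble_opE.
apply: rpred_sum => j _; apply: rpred_sum => i _.
by apply/eqP; apply: factor_kerS (kernel_eq0 _).
Qed.

Definition assemble H : weak_sym P := WeakSym (assemble_weak_sym H).

(** On ker P_j, pi_j is the identity and the other pi_k vanish, so only the j-th
column of H contributes. *)
Lemma assemble_block_matrix H : block_matrix (assemble H) H.
Proof.
move=> j x xj def_x; rewrite /= assemble_opE (bigD1 j) // -[LHS]/(_ + _).
rewrite [X in _ + X]big1.
  rewrite addr0; apply: eq_bigr => i _; congr (kerval (H (i, j) _)).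
  by apply: kerval_inj; rewrite -[RHS](component_self (kernel_eq0 xj)) -def_x.
move=> k neq_kj; apply: big1 => i _.
have -> : kernel_projection k x = 0; last by rewrite !linear0.
apply: kerval_inj; rewrite -[LHS]/(component k (kerval x)) def_x.
by rewrite eq_sym in neq_kj; apply: component_other neq_kj (kernel_eq0 xj).
Qed.

Lemma blocks_bij : bijective blocks.
Proof.
exists assemble => [S | H].
  by apply: block_matrix_inj (assemble_block_matrix _) _; apply/block_matrixE.
by apply/esym/block_matrixE; apply: assemble_block_matrix.
Qed.

End Components.

(* Canonicity: the isomorphism sends S to its block matrix with respect to
   ker P = (+)_i ker P_i, which does not refer to the operators Q_i. *)
Theorem theorem4p1 (F : fieldType) (V : lmodType F) (l : nat)
    (P : {linear V -> V}) (Ps : 'I_l.+1 -> {linear V -> V}) :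
  is_decomposition P Ps ->
  exists Phi : {linear weak_sym P -> hom_blocks Ps},
    bijective Phi /\
    forall (S : weak_sym P) (H : hom_blocks Ps),
      block_matrix S H <-> H = Phi S.
Proof.
case=> _ defP [Q [partition1 PsC PsQC]].
exists (blocks_linear defP PsC PsQC); split; first exact: blocks_bij.
exact: block_matrixE.
Qed.
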